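(* Let $\mathcal{G}$ be a graph equipped with an adapted complex structure $J$. If $w$ is an odd vertex in $\mathcal{G}$ then $Jw$ is (up to sign) another vertex in $\mathcal{G}$ with odd degree. In particular, the set of odd vertices of $\mathcal{G}$ is $J$-invariant (up to sign).
   Context: Graphs are finite and simple. A vertex is odd if its degree is odd. For a graph $\mathcal{G}=(V,E)$ label $V=\{v_1,\dots,v_n\}$ and write $e_{i,j}$ ($i<j$) for the edge joining $v_i$ and $v_j$, if it exists. The Lie algebra $\mathfrak{n}_{\mathcal{G}}$ is the real vector space with basis $V\cup E$ and Lie bracket $[v_i,v_j]=e_{i,j}$ for $i<j$ if $v_i,v_j$ are adjacent, $[v_i,v_j]=0$ if they are not adjacent, and all elements of $E$ central. A complex structure on a real Lie algebra $\mathfrak{g}$ is a linear map $J:\mathfrak{g}\to\mathfrak{g}$ with $J^2=-\mathrm{Id}$ and $[x,y]+J([Jx,y]+[x,Jy])-[Jx,Jy]=0$ for all $x,y\in\mathfrak{g}$. An adapted complex structure on the graph $\mathcal{G}$ is a complex structure $J$ on $\mathfrak{n}_{\mathcal{G}}$ such that for every $x\in V\cup E$ either $Jx\in V\cup E$ or $-Jx\in V\cup E$. ''$Jw$ is, up to sign, a vertex'' means that $Jw$ or $-Jw$ belongs to $V$; a subset $S\subseteq V\cup E$ is $J$-invariant up to sign if for each $x\in S$ either $Jx\in S$ or $-Jx\in S$. *)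

(* Defs.v *)
From mathcomp Require Import all_boot all_order all_algebra.
From mathcomp Require Import reals ring.

Set Implicit Arguments.
Unset Strict Implicit.
Unset Printing Implicit Defensive.
Import Order.TTheory GRing.Theory Num.Theory.
Local Open Scope ring_scope.

Record sgraph (n : nat) := SGraph {
  adj : rel 'I_n;
  adj_sym : symmetric adj;
  adj_irrefl : irreflexive adj
}.

Section Graph.
Variables (n : nat) (G : sgraph n).

Definition degree (v : 'I_n) : nat := #|[set u | adj G v u]|.

Definition odd_vertex (v : 'I_n) : bool := odd (degree v).

(* Each edge is represented once, by its endpoints in increasing order. *)
Definition edge : Type := {p : 'I_n * 'I_n | (p.1 < p.2)%N && adj G p.1 p.2}.

(* V and E together: the index set of the standard basis. *)
Definition cell : Type := ('I_n + edge)%type.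

Definition vertex_cell (v : 'I_n) : cell := inl v.
Definition edge_cell (e : edge) : cell := inr e.

Definition odd_cells : {set cell} :=
  [set vertex_cell v | v : 'I_n & odd_vertex v].

End Graph.

Section LieAlgebra.
Variables (R : realType) (L : lmodType R).

Definition is_lie_bracket (br : L -> L -> L) : Prop :=
  [/\ forall (a : R) x y z, br (a *: x + y) z = a *: br x z + br y z,
      forall (a : R) x y z, br x (a *: y + z) = a *: br x y + br x z,
      forall x, br x x = 0
    & forall x y z, br x (br y z) + br y (br z x) + br z (br x y) = 0].

Definition complex_structure (br : L -> L -> L) (J : {linear L -> L}) : Prop :=
  (forall x, J (J x) = - x) /\
  (forall x y, br x y + J (br (J x) y + br x (J y)) - br (J x) (J y) = 0).

End LieAlgebra.

Section GraphLieAlgebra.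
Variables (R : realType) (n : nat) (G : sgraph n).

Definition graph_lie : lmodType R := {ffun cell G -> R^o}.

Definition basis_vec (c : cell G) : graph_lie := [ffun d => (d == c)%:R].

Definition vertex_vec (v : 'I_n) : graph_lie := basis_vec (vertex_cell G v).
Definition edge_vec (e : edge G) : graph_lie := basis_vec (edge_cell e).

(* The bilinear extension, in coordinates, of [v_i, v_j] = e_{i,j} for
   adjacent i < j: the coefficient on e_{i,j} is x_i y_j - x_j y_i. The lemmas
   below check the defining relations and the Lie algebra axioms. *)
Definition bracket_coef (x y : graph_lie) (c : cell G) : R :=
  match c with
  | inl _ => 0
  | inr e =>
      x (vertex_cell G (val e).1) * y (vertex_cell G (val e).2) -
      x (vertex_cell G (val e).2) * y (vertex_cell G (val e).1)
  end.

Definition graph_bracket (x y : graph_lie) : graph_lie :=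
  [ffun c => bracket_coef x y c].

Lemma vertex_vecE (i j : 'I_n) : vertex_vec i (vertex_cell G j) = (j == i)%:R.
Proof. by rewrite ffunE. Qed.

Lemma graph_bracket_adj (e : edge G) :
  graph_bracket (vertex_vec (val e).1) (vertex_vec (val e).2) = edge_vec e.
Proof.
have /andP[ltij _] := valP e.
apply/ffunP => -[v|f]; rewrite !ffunE //= !vertex_vecE -!natrM.
rewrite (_ : (inr f == edge_cell e) =
             ((val f).1 == (val e).1) && ((val f).2 == (val e).2)); last first.
  by rewrite -[RHS]/(val f == val e :> _ * _).
have /andP[ltkl _] := valP f.
rewrite !mulnb; case: (boolP (((val f).2 == _) && _)) => [|_].
  by case/andP=> /eqP def2 /eqP def1; move: ltkl;
     rewrite def1 def2 ltnNge (ltnW ltij).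
by rewrite subr0.
Qed.

Lemma graph_bracket_nadj (i j : 'I_n) :
  ~~ adj G i j -> graph_bracket (vertex_vec i) (vertex_vec j) = 0.
Proof.
move=> nij; apply/ffunP => -[v|f]; rewrite !ffunE //= !vertex_vecE -!natrM.
have /andP[_ adjf] := valP f.
rewrite !mulnb; case: andP => [[/eqP d1 /eqP d2]|_].
  by case/negP: nij; rewrite -d1 -d2.
case: andP => [[/eqP d2 /eqP d1]|_]; last by rewrite subr0.
by case/negP: nij; rewrite adj_sym -d1 -d2.
Qed.

Lemma graph_bracket_central (e : edge G) (x : graph_lie) :
  graph_bracket (edge_vec e) x = 0.
Proof.
by apply/ffunP => -[v|f]; rewrite !ffunE //= !ffunE /= !mul0r subr0.
Qed.

Lemma graph_bracket_lie : is_lie_bracket graph_bracket.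
Proof.
split=> [a x y z|a x y z|x|x y z]; apply/ffunP => -[v|f];
  rewrite !ffunE /= ?ffunE /= ?scaler0 ?addr0 //.
- by rewrite /GRing.scale /=; ring.
- by rewrite /GRing.scale /=; ring.
- by rewrite mulrC subrr.
- by rewrite !mulr0 !subr0 !addr0.
Qed.

Lemma basis_vec_decomp (x : graph_lie) : x = \sum_c x c *: basis_vec c.
Proof.
apply/ffunP => d; rewrite sum_ffunE (bigD1 d) //= !ffunE eqxx.
rewrite big1 => [|c /negPf cd]; last by rewrite !ffunE eq_sym cd scaler0.
by rewrite addr0 /GRing.scale /= mulr1.
Qed.

Definition sign_invariant (J : graph_lie -> graph_lie) (S : {set cell G}) :
    Prop :=
  forall c, c \in S ->
  exists2 d, d \in S &
    J (basis_vec c) = basis_vec d \/ - J (basis_vec c) = basis_vec d.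

Definition adapted_complex_structure (J : {linear graph_lie -> graph_lie}) :
    Prop :=
  complex_structure graph_bracket J /\ sign_invariant J [set: cell G].

End GraphLieAlgebra.

(* Main.v *)
(* The parity of the coordinate sum of an integral vector of [graph_lie] is
   additive and preserved by an adapted [J], which sends basis vectors to
   signed basis vectors. On the bracket of two cells it is the adjacency bit.
   Writing [s c] for the cell such that [J c = +- s c], the integrability
   equation for [c] and [d] therefore reads, modulo 2,
   [c ~ d] + [s c ~ d] = [c ~ s d] + [s c ~ s d].
   Hence the cells adjacent to exactly one of [c] and [s c] form a set stable
   under the fixed-point-free involution [s]. This set has even size, so [c] and
   [s c] have degrees of the same parity, an edge having degree 0. *)
Require Import Defs.
From mathcomp Require Import all_boot all_order all_algebra.
From mathcomp Require Import reals ring zify.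
Set Implicit Arguments.
Unset Strict Implicit.
Unset Printing Implicit Defensive.
Import GRing.Theory Num.Theory.
Local Open Scope ring_scope.

(** Each orbit of [f] has two elements. Those of lower [enum_rank] in their orbit form [B], and [f]
    exchanges [A :&: B] with [A :\: B]. *)
Lemma even_card_involution (T : finType) (f : T -> T) (A : {set T}) :
  involutive f -> (forall x, f x != x) -> (forall x, x \in A -> f x \in A) ->
  ~~ odd #|A|.
Proof.
move=> fK fN fA.
have fAE x : (f x \in A) = (x \in A).
  by apply/idP/idP => [/fA|/fA //]; rewrite fK.
pose B := [set x | (enum_rank x < enum_rank (f x))%N].
suff -> : #|A| = (#|A :&: B| + #|A :&: B|)%N by rewrite addnn odd_double.
rewrite -(cardsID B A); congr addn.
rewrite -[in RHS](card_imset _ (inv_inj fK)); apply: eq_card => x.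
rewrite -{2}[x]fK (mem_imset _ _ (inv_inj fK)) !inE fAE fK andbC.
rewrite -leqNgt leq_eqVlt; case: eqP => // /ord_inj /enum_rank_inj fx.
by have := fN x; rewrite fx eqxx.
Qed.

Lemma odd_card_symdiff (T : finType) (A B : pred T) :
  odd #|[set x | A x (+) B x]| = odd #|A| (+) odd #|B|.
Proof.
have oddE (P : pred T) : odd #|P| = \big[addb/false]_x P x.
  rewrite -sum1_card big_mkcond (big_morph odd oddD (erefl _)).
  by apply: eq_bigr => x _; rewrite unfold_in; case: (P x).
by rewrite !oddE -big_split; apply: eq_bigr => x _; exact: in_set.
Qed.

Section CellAdjacency.
Variables (n : nat) (G : sgraph n).

(** Edges count as isolated cells, so that sums over all cells make sense before it is known that
    the partner of an odd vertex is a vertex. *)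
Definition cell_adj (c d : cell G) : bool :=
  match c, d with inl u, inl v => adj G u v | _, _ => false end.

Lemma card_cell_adj_vertex (v : 'I_n) :
  #|cell_adj (vertex_cell G v)| = degree G v.
Proof.
rewrite /degree -(card_imset _ (@inl_inj 'I_n (edge G))); apply: eq_card.
case=> [u|e].
  by rewrite (mem_imset _ _ (@inl_inj _ _)) inE.
by rewrite unfold_in; apply/esym/negbTE/imsetP => -[].
Qed.

Lemma card_cell_adj_edge (e : edge G) : #|cell_adj (edge_cell e)| = 0%N.
Proof. exact: eq_card0. Qed.

End CellAdjacency.

Section Parity.
Variables (R : realType) (n : nat) (G : sgraph n).
Local Notation L := (graph_lie R G).
Local Notation b := (@basis_vec R n G).

(** A relation, since a general real vector has no parity: it records a way of writing the vector as
    a signed sum of basis vectors, with the number of terms modulo 2. Uniqueness of the bit is used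
    only at 0, through [parity0F]. *)
Inductive parity : L -> bool -> Prop :=
| Parity0 : parity 0 false
| ParityS x p (s : bool) c : parity x p -> parity (x + (-1) ^+ s *: b c) (~~ p).

Lemma parityD x y p q : parity x p -> parity y q -> parity (x + y) (p (+) q).
Proof.
move=> px; elim=> [|{}y {}q s c _ IH]; first by rewrite addr0 addbF.
by rewrite addrA addbN; apply: ParityS.
Qed.

Lemma parity_basis (s : bool) c : parity ((-1) ^+ s *: b c) true.
Proof.
by rewrite -[_ *: _]add0r; apply: (@ParityS _ false); apply: Parity0.
Qed.

Lemma parity_sign (t : bool) x p : parity x p -> parity ((-1) ^+ t *: x) p.
Proof.
elim=> [|{}x {}p s c _ IH]; first by rewrite scaler0; apply: Parity0.
by rewrite scalerDr scalerA -signr_addb; apply: ParityS.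
Qed.

(** The coordinate sum of a signed sum of basis vectors is an integer of the recorded parity, and at
    0 this integer is 0. *)
Lemma parity0F p : parity 0 p -> p = false.
Proof.
have coord_sum x q : parity x q ->
    exists2 m : int, \sum_c (x c : R) = m%:~R :> R & odd `|m|%N = q.
  elim=> [|{}x {}q s c _ [m sx <-]].
    by exists 0 => //; rewrite big1 // => c _; rewrite ffunE.
  (* One more signed basis vector changes the coordinate sum by 1 or -1. *)
  exists (m + (-1) ^+ s).
    rewrite rmorphD rmorphXn rmorphN1 /= -sx.
    under eq_bigr do rewrite !ffunE.
    rewrite big_split /= (bigD1 c) //= [X in _ + X](bigD1 c) //= eqxx.
    rewrite [X in _ + (_ + X)]big1 => [|d /negPf ->]; last by rewrite scaler0.
    by rewrite addr0 /GRing.scale /= mulr1.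
  by case: s; rewrite ?expr0 ?expr1; lia.
case/coord_sum=> m; rewrite big1 => [|c _]; last by rewrite ffunE.
by move/esym/eqP; rewrite intr_eq0 => /eqP-> <-.
Qed.

Lemma graph_bracketZ a a' (x y : L) :
  graph_bracket (a *: x) (a' *: y) = (a * a') *: graph_bracket x y.
Proof.
apply/ffunP => -[v|e]; rewrite !ffunE /= ?scaler0 // !ffunE /GRing.scale /=.
ring.
Qed.

Lemma graph_bracketC (x y : L) : graph_bracket x y = - graph_bracket y x.
Proof. by apply/ffunP => -[v|e]; rewrite !ffunE /= ?oppr0 //; ring. Qed.

Lemma parity_bracket c d : parity (graph_bracket (b c) (b d)) (cell_adj c d).
Proof.
case: c d => [u|e] [v|f]; rewrite /cell_adj; last 3 first.
- rewrite graph_bracketC [X in - X]graph_bracket_central oppr0; exact: Parity0.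
- rewrite [X in parity X]graph_bracket_central; exact: Parity0.
- rewrite [X in parity X]graph_bracket_central; exact: Parity0.
case: (boolP (adj G u v)) => [uv|nuv]; last first.
  by rewrite [X in parity X]graph_bracket_nadj //; apply: Parity0.
have [lt_uv|lt_vu|/ord_inj eq_uv] := ltngtP u v.
- have ok : ((u, v).1 < (u, v).2)%N && adj G (u, v).1 (u, v).2 by rewrite lt_uv.
  rewrite [X in parity X](graph_bracket_adj R (exist _ (u, v) ok)).
  by rewrite -[edge_vec _ _]scale1r; apply: (parity_basis false).
(* The edge is stored as [(v, u)], so the bracket is minus its basis vector; the parity ignores the
   sign. *)
- have ok : ((v, u).1 < (v, u).2)%N && adj G (v, u).1 (v, u).2.
    by rewrite lt_vu adj_sym.
  rewrite graph_bracketC [X in - X](graph_bracket_adj R (exist _ (v, u) ok)).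
  by rewrite -scaleN1r; apply: (parity_basis true).
- by rewrite eq_uv adj_irrefl in uv.
Qed.

Lemma signed_basis_inj (s t : bool) c d :
  (-1) ^+ s *: b c = (-1) ^+ t *: b d -> c = d /\ s = t.
Proof.
move/ffunP/(_ c); rewrite !ffunE eqxx /GRing.scale /=.
case: eqP => [-> | _ /eqP]; last by rewrite mulr0 mulr1 signr_eq0.
by rewrite !mulr1 => /signr_inj.
Qed.

End Parity.

Section Adapted.
Variables (R : realType) (n : nat) (G : sgraph n).
Variable J : {linear graph_lie R G -> graph_lie R G}.
Hypothesis hJ : adapted_complex_structure J.
Local Notation b := (@basis_vec R n G).

Lemma adapted_signed_map : exists (s : cell G -> cell G) (t : cell G -> bool),
  forall c, J (b c) = (-1) ^+ t c *: b (s c).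
Proof.
have hs c : exists p : cell G * bool, J (b c) = (-1) ^+ p.2 *: b p.1.
  have [d _ [Jc|Jc]] := hJ.2 c (in_setT c).
    by exists (d, false); rewrite scale1r.
  by exists (d, true); rewrite -Jc scaleN1r opprK.
have [p hp] := fin_all_exists hs.
by exists (fun c => (p c).1), (fun c => (p c).2).
Qed.

Section SignedMap.
Variables (s : cell G -> cell G) (t : cell G -> bool).
Hypothesis Js : forall c, J (b c) = (-1) ^+ t c *: b (s c).

Lemma J2_basis c :
  (-1) ^+ (t c (+) t (s c)) *: b (s (s c)) = (-1) ^+ true *: b c.
Proof. by rewrite signr_addb -scalerA -Js -linearZ -Js hJ.1.1 scaleN1r. Qed.

Lemma signed_map_involutive : involutive s.
Proof. by move=> c; have [] := signed_basis_inj (J2_basis c). Qed.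

(** If [s c = c], then [J] acts on [b c] by a sign, whose square is 1 and not -1. *)
Lemma signed_map_neq c : s c != c.
Proof.
apply/eqP => sc; have [_] := signed_basis_inj (J2_basis c).
by rewrite sc addbb.
Qed.

Lemma parity_adapted x p : parity x p -> parity (J x) p.
Proof.
elim=> [|{}x {}p u c _ IH]; first by rewrite linear0; apply: Parity0.
rewrite linearD linearZ /= Js scalerA -signr_addb; exact: ParityS.
Qed.

Lemma cell_adj_integrable c d :
  cell_adj c d (+) cell_adj (s c) d =
  cell_adj c (s d) (+) cell_adj (s c) (s d).
Proof.
have par (u v : bool) c' d' :
    parity (graph_bracket ((-1) ^+ u *: b c') ((-1) ^+ v *: b d'))
    (cell_adj c' d').
  by rewrite graph_bracketZ -signr_addb; apply/parity_sign/parity_bracket.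
(* The trivial sign 1 is inserted so that [par] covers all four brackets. *)
have := hJ.1.2 (b c) (b d); rewrite !Js -[b c]scale1r -[b d]scale1r => N0.
(* The parity of the left side of the integrability equation is the sum of four adjacency bits; the
   vector being 0, the sum is false. *)
have := parityD (parityD (par false false c d) (parity_adapted (parityD
  (par (t c) false (s c) d) (par false (t d) c (s d)))))
  (parity_sign true (par (t c) (t d) (s c) (s d))).
rewrite [(-1) ^+ true *: _]scaleN1r [X in parity X]N0 => /parity0F.
by do 4!case: cell_adj.
Qed.

Lemma odd_card_cell_adj c : odd #|cell_adj (s c)| = odd #|cell_adj c|.
Proof.
apply/esym/eqP; rewrite -negb_add -odd_card_symdiff.
apply: even_card_involution signed_map_involutive signed_map_neq _ => d.
by rewrite !inE cell_adj_integrable.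
Qed.

End SignedMap.

Lemma adapted_odd_vertex (w : 'I_n) : odd_vertex G w ->
  exists w' : 'I_n, [/\ w' != w, odd_vertex G w' &
    J (vertex_vec R G w) = vertex_vec R G w' \/
    - J (vertex_vec R G w) = vertex_vec R G w'].
Proof.
have [s [t Js]] := adapted_signed_map => odd_w.
have := odd_card_cell_adj Js (vertex_cell G w).
have := signed_map_neq Js (vertex_cell G w); have := Js (vertex_cell G w).
rewrite card_cell_adj_vertex [odd (degree _ _)]odd_w.
(* An edge has no adjacent cell, so it cannot share the odd parity of [w]. *)
case: (s _) => [w'|e] Jw ne_w; last by rewrite card_cell_adj_edge.
rewrite card_cell_adj_vertex => odd_w'; exists w'; split=> //.
rewrite /vertex_vec Jw; case: (t _); last by left; rewrite scale1r.
by right; rewrite scaleN1r opprK.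
Qed.

End Adapted.

Theorem corollary4p9 (R : realType) (n : nat) (G : sgraph n)
    (J : {linear graph_lie R G -> graph_lie R G})
    (hJ : adapted_complex_structure J) :
  (forall w : 'I_n, odd_vertex G w ->
     exists w' : 'I_n,
       [/\ w' != w, odd_vertex G w' &
           J (vertex_vec R G w) = vertex_vec R G w' \/
           - J (vertex_vec R G w) = vertex_vec R G w']) /\
  sign_invariant J (odd_cells G).
Proof.
split=> [w|_ /imsetP[w odd_w ->]]; first exact: adapted_odd_vertex.
rewrite inE in odd_w.
have [w' [_ odd_w' Jw]] := adapted_odd_vertex hJ odd_w.
by exists (vertex_cell G w') => //; apply: imset_f; rewrite inE.
Qed.
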